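(* Let $\theta>0$ and $\mathsf{M}\in(0,\theta]$, put $M_N=\lfloor\mathsf{M}N\rfloor$, and let $\mathbb{P}^{\theta,M_N}_{\beta,N}$ be the measure defined in the context. Then for any $t\in[\theta,\mathsf{M}+\theta)$, $$\lim_{N\to\infty}\frac1N\log\mathbb{P}^{\theta,M_N}_{\beta,N}(\ell_1\ge tN)=0.$$
   Context: $\mathbb{W}^{\theta,M}_N$ is the set of $(\ell_1,\dots,\ell_N)$ with $\ell_i=\lambda_i+(N-i)\theta$, where $M\ge\lambda_1\ge\cdots\ge\lambda_N\ge0$ are integers. The probability measure $\mathbb{P}^{\theta,M}_{\beta,N}$ on $\mathbb{W}^{\theta,M}_N$ is $$\mathbb{P}^{\theta,M}_{\beta,N}(\vec\ell)=\frac1{Z}\prod_{1\le i<j\le N}\frac{\Gamma(\ell_i-\ell_j+\theta)\Gamma(\ell_i-\ell_j+1)}{\Gamma(\ell_i-\ell_j)\Gamma(\ell_i-\ell_j+1-\theta)}\prod_{i=1}^N\frac1{\Gamma(\ell_i+1)\,\Gamma(M+N\theta-\ell_i+1-\theta)},$$ with $Z$ the normalization constant. (The subscript $\beta$ is just a label.) *)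

(* Defs.v *)
From HB Require Import structures.
From mathcomp Require Export all_boot all_order all_algebra.
From mathcomp Require Export all_classical all_reals all_analysis.
Export Order.TTheory GRing.Theory Num.Theory.
Export numFieldNormedType.Exports.

Set Implicit Arguments.
Unset Strict Implicit.
Unset Printing Implicit Defensive.

Local Open Scope classical_set_scope.
Local Open Scope ring_scope.

(* Euler's integral, which is the Gamma function on x > 0. For theta > 0, the
   formulas below only evaluate Gamma at positive reals: on W^{theta,M}_N one
   has l_i - l_j >= theta for i < j, and 0 <= l_i <= M + (N - 1) theta. *)
Definition Gamma (R : realType) (x : R) : R :=
  \int[lebesgue_measure]_(u in `]0, +oo[) (u `^ (x - 1) * expR (- u)).

(* M >= lambda_1 >= ... >= lambda_N >= 0; the component lambda_k is stored at
   index k - 1, and so is l_k below. *)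
Definition nonincreasing_parts (M N : nat) (lam : N.-tuple 'I_M.+1) : bool :=
  sorted geq [seq val k | k <- lam].

(* W^{theta,M}_N consists of the tuples [ell theta lam] with
   [nonincreasing_parts lam]; the correspondence is one-to-one. *)
Definition ell (R : realType) (theta : R) (M N : nat)
    (lam : N.-tuple 'I_M.+1) : N.-tuple R :=
  [tuple (val (tnth lam i))%:R + (N - i.+1)%:R * theta | i < N].

Definition weight (R : realType) (theta : R) (M N : nat) (l : N.-tuple R) : R :=
  (\prod_(i < N) \prod_(j < N | (i < j)%N)
     ((Gamma (l`_i - l`_j + theta) * Gamma (l`_i - l`_j + 1)) /
      (Gamma (l`_i - l`_j) * Gamma (l`_i - l`_j + 1 - theta)))) *
  \prod_(i < N)
     (1 / (Gamma (l`_i + 1) * Gamma (M%:R + N%:R * theta - l`_i + 1 - theta))).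

Definition partition_function (R : realType) (theta : R) (M N : nat) : R :=
  \sum_(lam : N.-tuple 'I_M.+1 | nonincreasing_parts lam)
     weight theta M (ell theta lam).

Definition ensemble_pmf (R : realType) (theta : R) (M N : nat)
    (l : N.-tuple R) : R :=
  (partition_function theta M N)^-1 * weight theta M l.

Definition ensemble_prob (R : realType) (theta : R) (M N : nat)
    (A : pred (N.-tuple R)) : R :=
  \sum_(lam : N.-tuple 'I_M.+1 | nonincreasing_parts lam && A (ell theta lam))
     ensemble_pmf theta M (ell theta lam).

(* Main.v *)
Require Import Defs.
From mathcomp Require Import measurable_realfun ring lra zify.

Set Implicit Arguments.
Unset Strict Implicit.
Unset Printing Implicit Defensive.

Local Open Scope classical_set_scope.
Local Open Scope ring_scope.

(** Since a probability is at most 1, only a lower bound is at stake, and the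
    event turns out to have probability at least c / N for a constant c > 0
    depending on theta alone. The bound comes from the Nekrasov (discrete loop)
    equation of the ensemble, which for this weight is exactly solvable.

    Write C = M + (N - 1) theta + 1, one more than the largest possible value
    of l_1. For the law P of the ensemble, the function
      z E[prod_i (1 - theta / (z - l_i))]
        + (C - z) E[prod_i (1 + theta / (z - 1 - l_i))]
    has no poles: the residue of the first term at a configuration l + e_i
    cancels the residue of the second term at l, because the functional
    equation of Gamma makes the ratio of the two weights the right rational
    function ([weight_shift]). Being bounded at infinity it is the constant
    C - 2 theta N. At z = C the second term only sees configurations with
    l_1 = C - 1, and the equation reads
      E[C prod_i (1 - theta / (C - l_i))]
        = C - 2 theta N + theta E[1_{l_1 = C - 1} prod_{j > 1} (1 + theta / (l_1 - l_j))].
    The last product is at most N, because l_1 - l_j >= (j - 1) theta makes it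
    telescope; this yields the inequality [nekrasov_bound], which is all that
    is used.

    Now let p be the probability of {l_1 >= T} for some T <= C - theta - 1.
    Off this event, C - l_i >= 1 + i theta, and the product on the left is at
    least 1 / (1 + N theta); on it, only the factor of l_1 can be negative and
    the product is at least - theta. Hence
      (1 - p) C / (1 + N theta) - p C theta <= C - 2 theta N + theta N p.
    When M <= theta N, which is the hypothesis Mm <= theta, the p-free terms
    leave a positive constant against p times a multiple of N
    ([event_weight_bound], [ensemble_prob_ge]). The hypothesis t < Mm + theta
    is what puts T = t N below C for large N. *)

(** * Euler's Gamma integral *)

Section Gamma.
Variable R : realType.
Implicit Types x u a b : R.
Local Notation mu := (@lebesgue_measure R).

Definition gamma_density x u : R := u `^ (x - 1) * expR (- u).

(** The extended-real integral, so that the functional equation can be proved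
    before finiteness, which is then deduced from it. *)
Definition eGamma x : \bar R :=
  (\int[mu]_(u in `]0%R, +oo[) (gamma_density x u)%:E)%E.

Lemma gamma_density_ge0 x u : 0 <= gamma_density x u.
Proof. by rewrite mulr_ge0 ?powR_ge0 ?expR_ge0. Qed.

Lemma measurable_gamma_density x : measurable_fun setT (gamma_density x).
Proof.
apply: measurable_funM; first exact: measurable_powR.
by apply: measurableT_comp => //; exact: measurable_funN.
Qed.

Lemma derivable_powRr x u : 0 < u -> derivable (fun v : R => v `^ x) u 1.
Proof. by move=> u0; apply: derivable_powR; rewrite in_itv/= u0. Qed.

Lemma continuous_powRr x u : 0 < u -> {for u, continuous (fun v : R => v `^ x)}.
Proof.
by move=> u0; apply/differentiable_continuous/derivable1_diffP/derivable_powRr.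
Qed.

Lemma within_continuous_powR x a b : 0 < a ->
  {within `[a, b], continuous (fun v : R => v `^ x)}.
Proof.
move=> a0; apply: continuous_in_subspaceT => u; rewrite inE/= in_itv/= => /andP[au _].
by apply: continuous_powRr; exact: lt_le_trans au.
Qed.

Lemma continuous_expRN : continuous (fun u : R => expR (- u)).
Proof.
move=> u; apply: continuous_comp; last exact: continuous_expR.
exact: (@opp_continuous R^o).
Qed.

Lemma is_derive_NexpRN u :
  is_derive u 1 (fun v : R => - expR (- v)) (expR (- u)).
Proof.
have dN : is_derive u (1 : R) (fun v : R => - v) (-1) by exact: is_deriveN.
have := is_deriveN (is_derive1_comp (is_derive_expR (- u)) dN).
by rewrite mulrN1 opprK.
Qed.

Lemma gamma_by_parts x a b : 0 < a -> a < b ->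
  (\int[mu]_(u in `[a, b]) (gamma_density (x + 1) u)%:E =
   (a `^ x * expR (- a) - b `^ x * expR (- b))%:E
   + x%:E * \int[mu]_(u in `[a, b]) (gamma_density x u)%:E)%E.
Proof.
move=> a0 ab.
have b0 : 0 < b by exact: lt_trans ab.
have := @integration_by_parts R (fun u => u `^ x) (fun u => - expR (- u))
  (fun u => x * u `^ (x - 1)) (fun u => expR (- u)) a b ab.
move=> H.
rewrite /gamma_density.
under eq_integral do rewrite addrK.
rewrite H; first last.
- by move=> u _ /=; rewrite derive1E (@derive_val _ _ _ _ _ _ _ (is_derive_NexpRN u)).
- split.
  + by move=> u _; exact: (@ex_derive _ _ _ _ _ _ _ (is_derive_NexpRN u)).
  + apply: cvgN; apply: cvg_at_right_filter; exact: continuous_expRN.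
  + apply: cvgN; apply: cvg_at_left_filter; exact: continuous_expRN.
- by apply: continuous_subspaceT => u; exact: continuous_expRN.
- move=> u /=; rewrite in_itv/= => /andP[au _]; rewrite powR_derive1//.
  by rewrite in_itv/= andbT (lt_trans a0).
- split.
  + by move=> u; rewrite in_itv/= => /andP[au _]; apply: derivable_powRr; exact: lt_trans au.
  + by apply: cvg_at_right_filter; exact: continuous_powRr.
  + by apply: cvg_at_left_filter; exact: continuous_powRr.
- move=> u; apply: cvgM; [exact: cvg_cst|exact: within_continuous_powR].
congr (_ + _)%E; first by rewrite !mulrN opprK addrC.
under eq_integral do rewrite mulrN -mulrA -mulNr EFinM.
rewrite integralZl// ?EFinN ?mulNe ?oppeK//.
apply: continuous_compact_integrable; first exact: segment_compact.
move=> u; apply: cvgM; first exact: within_continuous_powR.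
by apply: (@continuous_subspaceT _ _ _ (fun u => expR (- u))) => v; exact: continuous_expRN.
Qed.

Lemma powR_expRN_le x u : 1 <= u ->
  u `^ x * expR (- u) <= (Num.truncn x).+2`!%:R / u.
Proof.
move=> u1; have u0 : 0 < u by exact: lt_le_trans u1.
set k := (Num.truncn x).+1.
have ux : u `^ x <= u ^+ k.
  by rewrite -(powR_mulrn k (ltW u0)); apply: ler_powR; rewrite //= ltW// truncnS_gt.
have := expR_ge1Dxn k (ltW u0) => eu.
rewrite expRN ler_pdivrMr ?expR_gt0// mulrAC ler_pdivlMr//.
apply: (le_trans (ler_wpM2r (ltW u0) ux)); rewrite -exprSr.
rewrite -ler_pdivrMl ?ltr0n ?fact_gt0// mulrC; apply: le_trans eu.
by rewrite lerDr.
Qed.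

Lemma cvg_gamma_boundary x : 0 < x ->
  ((n.+2%:R^-1 : R) `^ x * expR (- n.+2%:R^-1) -
   n.+2%:R `^ x * expR (- n.+2%:R)) @[n --> \oo] --> (0 : R).
Proof.
move=> x0.
have h0 : (n.+2%:R^-1 : R) @[n --> \oo] --> (0 : R).
  by have := @cvg_harmonic R; rewrite -(cvg_shiftS).
rewrite -[0 in X in _ --> X]subr0; apply: cvgB.
- rewrite -[0 in X in _ --> X](mul0r (expR (- 0))); apply: cvgM.
    by apply: (cvg_at_rightP _ _ _).1 (powR_cvg0 x0) _ _; split.
  by apply: (cvg_comp (fun n => (n.+2%:R^-1 : R)) (fun u : R => expR (- u)) h0);
     exact: continuous_expRN.
- apply: (@squeeze_cvgr _ _ _ _ (fun=> 0) (fun n => (Num.truncn x).+2`!%:R * n.+2%:R^-1)).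
  + apply: nearW => n; rewrite mulr_ge0 ?powR_ge0 ?expR_ge0//=.
    by apply: powR_expRN_le; rewrite ler1n.
  + exact: cvg_cst.
  + rewrite -[0 in X in _ --> X](mulr0 (Num.truncn x).+2`!%:R).
    by apply: cvgM => //; exact: cvg_cst.
Qed.

Lemma bigcup_itv_invn :
  \bigcup_n `[(n.+2%:R^-1 : R), n.+2%:R]%classic = `]0, +oo[%classic.
Proof.
apply/seteqP; split=> u /=.
  by move=> [n _] /=; rewrite !in_itv/= andbT => /andP[+ _]; apply: lt_le_trans.
rewrite in_itv/= andbT => u0.
exists (Num.truncn u + Num.truncn u^-1)%N => //=; rewrite in_itv/=; apply/andP; split.
  rewrite invf_ple ?posrE//; apply/ltW; apply: (lt_le_trans (truncnS_gt _)).
  by rewrite ler_nat ltnS leqW// leq_addl.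
apply/ltW; apply: (lt_le_trans (truncnS_gt _)).
by rewrite ler_nat ltnS leqW// leq_addr.
Qed.

Lemma eGamma_cvg x :
  (\int[mu]_(u in `[(n.+2%:R^-1)%R, n.+2%:R%R]) (gamma_density x u)%:E)%E
   @[n --> \oo] --> eGamma x.
Proof.
rewrite /eGamma -bigcup_itv_invn; apply: ge0_nondecreasing_set_cvg_integral.
- move=> m n mn; rewrite subsetEset; apply: subset_itv.
    by rewrite bnd_simp lef_pV2 ?posrE// ler_nat.
  by rewrite bnd_simp ler_nat.
- by move=> i.
- by move=> i; apply/measurable_EFinP/measurable_funTS; exact: measurable_gamma_density.
- by move=> i u _; rewrite lee_fin gamma_density_ge0.
Qed.

(** Integration by parts on [1 / (n + 2), n + 2], where everything is continuous even when
    x < 1, followed by monotone convergence on both sides. *)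
Lemma eGammaD1 x : 0 < x -> eGamma (x + 1) = (x%:E * eGamma x)%E.
Proof.
move=> x0; have h1 := @eGamma_cvg (x + 1).
suff h2 : (\int[mu]_(u in `[(n.+2%:R^-1)%R, n.+2%:R%R]) (gamma_density (x + 1) u)%:E)%E
   @[n --> \oo] --> (x%:E * eGamma x)%E by exact: (cvg_unique _ h1 h2).
rewrite -[X in _ --> X]add0e.
have ab n : (n.+2%:R^-1 : R) < n.+2%:R.
  by rewrite (@lt_trans _ _ 1) ?invf_lt1 ?ltr1n.
under eq_fun do rewrite gamma_by_parts//.
apply: cvgeD; first exact: fin_num_adde_defr.
  by apply/fine_cvgP; split; [exact: nearW|exact: cvg_gamma_boundary].
by apply: cvgeZl => //; exact: eGamma_cvg.
Qed.

Lemma eGamma_ge0 x : (0 <= eGamma x)%E.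
Proof. by apply: integral_ge0 => u _; rewrite lee_fin gamma_density_ge0. Qed.

Lemma eGamma1 : eGamma 1 = 1%E.
Proof.
rewrite /eGamma; under eq_integral do rewrite /gamma_density subrr powRr0 mul1r.
rewrite integral_itv_obnd_cbnd; last first.
  apply/measurable_EFinP/measurable_funTS.
  by apply: continuous_measurable_fun; exact: continuous_expRN.
rewrite (@ge0_continuous_FTC2y _ _ (fun u => - expR (- u)) _ 0).
- by rewrite oppr0 expR0 sub0e EFinN oppeK.
- by move=> u _; exact: expR_ge0.
- by apply: continuous_subspaceT => u; exact: continuous_expRN.
- by rewrite -oppr0; apply: cvgN; exact: cvgr_expR.
- by move=> u _; exact: (@ex_derive _ _ _ _ _ _ _ (is_derive_NexpRN u)).
- by apply: cvgN; apply: cvg_at_right_filter; exact: continuous_expRN.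
- by move=> u _ /=; rewrite derive1E (@derive_val _ _ _ _ _ _ _ (is_derive_NexpRN u)).
Qed.

Lemma eGamma_nat n : (eGamma n.+1%:R < +oo)%E.
Proof.
elim: n => [|n IH]; first by rewrite eGamma1 ltry.
by rewrite -natr1 eGammaD1// lte_mul_pinfty.
Qed.

(** By the functional equation it suffices to treat x >= 1; there the integrand
    is dominated by those of Gamma at two positive integers. *)
Lemma eGamma_lty x : 0 < x -> (eGamma x < +oo)%E.
Proof.
wlog x1 : x / 1 <= x => [hw x0|_].
  have x1 : 1 <= x + 1 by rewrite lerDr ltW.
  have := hw _ x1 (lt_le_trans ltr01 x1); rewrite eGammaD1//.
  by case: (eGamma x) => [r _||//]; rewrite ?ltry// gt0_muley ?lte_fin.
set n := Num.truncn x.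
apply: (@le_lt_trans _ _ (eGamma 1%:R + eGamma n.+1%:R)%E); last first.
  by rewrite lte_add_pinfty// eGamma_nat.
have mg y : measurable_fun (`]0%R, +oo[%classic : set R) (fun u => (gamma_density y u)%:E).
  by apply/measurable_EFinP/measurable_funTS; exact: measurable_gamma_density.
have g0 y u : (`]0%R, +oo[%classic : set R) u -> (0 <= (gamma_density y u)%:E)%E.
  by move=> _; rewrite lee_fin gamma_density_ge0.
rewrite /eGamma -ge0_integralD//=; [|exact: g0|exact: mg|exact: g0|exact: mg].
apply: ge0_le_integral => //=; first exact: g0.
- exact: mg.
- by apply: emeasurable_funD; exact: mg.
move=> u; rewrite in_itv/= andbT => u0; rewrite lee_fin -mulrDl ler_wpM2r ?expR_ge0//.
rewrite subrr powRr0; have [u1|u1] := leP 1 u.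
  apply: (@le_trans _ _ (u `^ (n.+1%:R - 1))); last by rewrite lerDr.
  by apply: ler_powR => //; rewrite lerD2r ltW// truncnS_gt.
apply: (@le_trans _ _ 1); last by rewrite lerDl powR_ge0.
rewrite -[leRHS](powRr0 u); apply: ger_powR; last by rewrite subr_ge0.
by rewrite u0 ltW.
Qed.

Lemma eGamma_gt0 x : (0 < eGamma x)%E.
Proof.
(* A lower bound of the integrand on [1, 2], whatever the sign of x - 1. *)
pose c := Num.min 1 (2 `^ (x - 1)) * expR (- 2) : R.
have c0 : 0 < c by rewrite mulr_gt0 ?expR_gt0// lt_min ltr01 powR_gt0.
apply: (@lt_le_trans _ _ (\int[mu]_(u in `[1%R, 2%R]) c%:E)%E).
  by rewrite integral_cst//= lebesgue_measure_itv/= lte_fin ltr1n -EFinB mule_gt0// lte_fin; lra.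
apply: (@le_trans _ _ (\int[mu]_(u in `[1%R, 2%R]) (gamma_density x u)%:E)%E).
  apply: ge0_le_integral => //=.
  - by move=> u _; rewrite lee_fin ltW.
  - by apply/measurable_EFinP/measurable_funTS; exact: measurable_gamma_density.
  move=> u; rewrite in_itv/= => /andP[u1 u2]; rewrite lee_fin.
  apply: ler_pM; rewrite ?expR_ge0 ?ler_expR ?lerN2//.
  rewrite ge_min; have [x1|x1] := leP 1 x.
    by rewrite -{1}(powRr0 u); apply/orP; left; apply: ler_powR; rewrite ?subr_ge0.
  apply/orP; right.
  have u0 : (0 : R) < u by exact: lt_le_trans u1.
  have y0 : 0 <= - (x - 1) by rewrite oppr_ge0 subr_le0 ltW.
  rewrite -[x - 1]opprK; move: (- (x - 1)) y0 => y y0.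
  rewrite !powRN lef_pV2 ?posrE ?powR_gt0//.
  by apply: (ge0_ler_powR y0) => //; rewrite ?nnegrE ?(ltW u0).
apply: ge0_subset_integral => //=.
- by apply/measurable_EFinP/measurable_funTS; exact: measurable_gamma_density.
- by move=> u _; rewrite lee_fin gamma_density_ge0.
- by move=> u /=; rewrite !in_itv/= andbT => /andP[u1 _]; apply: lt_le_trans u1.
Qed.

Lemma Gamma_gt0 x : 0 < x -> 0 < Gamma x.
Proof.
by move=> x0; apply: fine_gt0; rewrite eGamma_gt0 eGamma_lty.
Qed.

Lemma GammaD1 x : 0 < x -> Gamma (x + 1) = x * Gamma x.
Proof.
move=> x0; rewrite /Gamma /Rintegral -/(eGamma (x + 1)) -/(eGamma x).
by rewrite eGammaD1// fineM// ge0_fin_numE ?eGamma_ge0// eGamma_lty.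
Qed.

End Gamma.

(** * Partial fractions *)

Section PartialFractions.
Variables (F : fieldType) (a : F).
Implicit Types (x : nat -> F) (z : F).

(** Up to the factor [a], the residue at [x i] of the product of the
    [1 + a / (z - x j)], as a function of [z]. *)
Definition residue n x i : F := \prod_(j < n | j != i :> nat) (1 + a / (x i - x j)).

Definition distinct_on n x := forall i j, (i < n)%N -> (j < n)%N -> i != j -> x i != x j.

Lemma residue_recr n x i : (i < n)%N ->
  residue n.+1 x i = residue n x i * (1 + a / (x i - x n)).
Proof.
move=> lin; rewrite /residue big_mkcond big_ord_recr /= -big_mkcond /=.
by rewrite gtn_eqF.
Qed.

Lemma residue_last n x : residue n.+1 x n = \prod_(j < n) (1 + a / (x n - x j)).
Proof.
rewrite /residue big_mkcond big_ord_recr /= eqxx mulr1.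
by apply: eq_bigr => j _; rewrite ltn_eqF.
Qed.

Lemma distinct_onS n x : distinct_on n.+1 x ->
  distinct_on n x /\ (forall i, (i < n)%N -> x n != x i).
Proof.
move=> h; split=> [i j lin ljn|i lin]; first by apply: h; exact: ltnW.
by apply: h; [exact: ltnSn|exact: ltnW|rewrite gtn_eqF].
Qed.

(** By induction on [n]: the product of the two simple poles at [x n] and [x i]
    is a combination of them, and the hypothesis taken at [x n] itself gives the
    coefficient of the new pole. *)
Lemma partial_fractions n x z : distinct_on n x ->
    (forall i, (i < n)%N -> z != x i) ->
  \prod_(j < n) (1 + a / (z - x j)) = 1 + \sum_(i < n) a / (z - x i) * residue n x i.
Proof.
elim: n z => [|n IH] z; first by rewrite !big_ord0 addr0.
move=> /distinct_onS[dn xn] zx.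
rewrite !big_ord_recr /= residue_last.
rewrite !IH//; last by move=> i lin; apply: zx; exact: ltnW.
under [in RHS]eq_bigr => i _ do rewrite residue_recr//.
have zn : z - x n != 0 by rewrite subr_eq0 zx.
set S := \sum_(i < n) _; set e := a / (z - x n).
set T := \sum_(i < n) _; set U := \sum_(i < n) _.
suff key : S + S * e = T + e * U.
  rewrite (_ : _ * _ = 1 + e + (S + S * e)); last by ring.
  by rewrite key; ring.
rewrite /S /T /U /e big_distrl big_distrr -!big_split /=; apply: eq_bigr => i _.
have zi : z - x i != 0 by rewrite subr_eq0 zx// ltnS ltnW.
have ni : x n - x i != 0 by rewrite subr_eq0 xn.
have ni' : x i - x n != 0 by rewrite subr_eq0 eq_sym xn.
by field; rewrite zi zn ni ni'.
Qed.

(** The new residue at [x n] is expanded by [partial_fractions], and its terms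
    cancel the corrections to the other residues. *)
Lemma sum_residue n x : distinct_on n x -> \sum_(i < n) residue n x i = n%:R.
Proof.
elim: n => [|n IH] h; first by rewrite big_ord0.
have [dn xn] := distinct_onS h.
rewrite big_ord_recr /= residue_last partial_fractions//.
rewrite -natr1 -(IH dn) addrA addrAC -big_split /=; congr (_ + _).
apply: eq_bigr => i _; rewrite residue_recr//.
have ni : x n - x i != 0 by rewrite subr_eq0 xn.
have ni' : x i - x n != 0 by rewrite subr_eq0 eq_sym xn.
by field; rewrite ni ni'.
Qed.

(** Writing [z / (z - x i)] as [1 + x i / (z - x i)] splits off the sum of the
    residues, which [sum_residue] evaluates. *)
Lemma partial_fractions_mul n x z : distinct_on n x ->
    (forall i, (i < n)%N -> z != x i) ->
  z * \prod_(j < n) (1 + a / (z - x j)) =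
  z + a * n%:R + \sum_(i < n) a * (x i * residue n x i) / (z - x i).
Proof.
move=> dx zx; rewrite partial_fractions// -(sum_residue dx).
rewrite mulrDr mulr1 -addrA; congr (_ + _).
rewrite !big_distrr -big_split /=; apply: eq_bigr => i _.
have zi : z - x i != 0 by rewrite subr_eq0 zx.
by field.
Qed.
End PartialFractions.

(** * The weight under a unit shift of one particle *)

Section Weight.
Variables (R : realType) (theta : R).

Definition pair_weight (d : R) : R :=
  (Gamma (d + theta) * Gamma (d + 1)) / (Gamma d * Gamma (d + 1 - theta)).

Lemma pair_weight_gt0 d : 0 < theta -> theta <= d -> 0 < pair_weight d.
Proof.
by move=> t0 hd; apply: divr_gt0; apply: mulr_gt0; apply: Gamma_gt0; lra.
Qed.

(** Both sides are the same product of Gamma values once the functional equation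
    is applied. This is the identity that makes poles cancel in the Nekrasov
    equation, for one pair of particles at distance [d]. *)
Lemma pair_weight_shift d : 0 < theta -> theta <= d ->
  pair_weight (d + 1) * (1 - theta / (d + 1)) = pair_weight d * (1 + theta / d).
Proof.
move=> t0 hd.
have d0 : 0 < d by lra.
have d1 : 0 < d + 1 by lra.
have dt : 0 < d + theta by lra.
have e0 : 0 < d + 1 - theta by lra.
rewrite /pair_weight (addrAC d 1 theta) (addrAC (d + 1) 1 (- theta)).
rewrite (GammaD1 d0) (GammaD1 d1) (GammaD1 dt) (GammaD1 e0) (GammaD1 d0).
move: (Gamma_gt0 d0) (Gamma_gt0 e0).
move: (Gamma d) (Gamma (d + theta)) (Gamma (d + 1 - theta)) => g g' g'' g0 g''0.
by field; rewrite !gt_eqF.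
Qed.

(** Isolates, in a product over all pairs, the pairs that contain a given index
    [k]; each other index occurs in exactly one of them. *)
Lemma prod_pairs_at (N k : nat) (f : nat -> R) : (k < N)%N ->
  \prod_(i < N) \prod_(j < N | (i < j)%N)
    (if i == k :> nat then f j else if j == k :> nat then f i else 1) =
  \prod_(j < N | j != k :> nat) f j.
Proof.
move=> kN; rewrite (bigD1 (Ordinal kN))//= eqxx.
have -> : \prod_(i < N | i != Ordinal kN)
  \prod_(j < N | (i < j)%N)
     (if i == k :> nat then f j else if j == k :> nat then f i else 1) =
  \prod_(i < N | (i < k)%N) f i.
  rewrite [RHS]big_mkcond/= [LHS]big_mkcond/=; apply: eq_bigr => i _.
  case: eqVneq => [->|]; first by rewrite ltnn.
  rewrite -val_eqE/= => ik; rewrite (negPf ik).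
  have [lik|nik] := ltnP i k.
    rewrite (bigD1 (Ordinal kN))//= eqxx big1 ?mulr1// => j /andP[_].
    by rewrite -val_eqE/= => /negPf ->.
  by apply: big1 => j lij; rewrite gtn_eqF//; apply: leq_ltn_trans lij.
rewrite [RHS](bigID (fun j : 'I_N => (k < j)%N))/=; congr (_ * _).
  by apply: eq_bigl => j; rewrite andbC; case: ltngtP.
by apply: eq_bigl => j; case: ltngtP.
Qed.

Definition interaction (N : nat) (l : nat -> R) : R :=
  \prod_(i < N) \prod_(j < N | (i < j)%N) pair_weight (l i - l j).

Definition one_body (M N : nat) (l : nat -> R) : R :=
  \prod_(i < N) (1 / (Gamma (l i + 1) * Gamma (M%:R + N%:R * theta - l i + 1 - theta))).

Lemma weightE (M N : nat) (l : N.-tuple R) :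
  weight theta M l = interaction N (nth 0 l) * one_body M N (nth 0 l).
Proof. by []. Qed.

Definition spaced (N : nat) (l : nat -> R) :=
  forall j k, (j < k < N)%N -> theta <= l j - l k.

Lemma interaction_shift (N : nat) (l l' : nat -> R) (i : nat) :
    0 < theta -> (i < N)%N ->
    (forall j, j != i -> l' j = l j) -> l' i = l i + 1 ->
    spaced N l -> spaced N l' ->
  interaction N l' * residue (- theta) N l' i = interaction N l * residue theta N l i.
Proof.
move=> t0 iN lj li sl sl'.
rewrite /residue -(@prod_pairs_at N i (fun j => 1 + - theta / (l' i - l' j)))//.
rewrite -(@prod_pairs_at N i (fun j => 1 + theta / (l i - l j)))//.
rewrite -[LHS]big_split -[RHS]big_split/=; apply: eq_bigr => j _.
rewrite -[LHS]big_split -[RHS]big_split/=; apply: eq_bigr => k jk.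
have jkN : (j < k < N)%N by rewrite jk ltn_ord.
case: eqVneq => [ji|ji].
  rewrite ji in jkN *; rewrite li (lj k); last by rewrite -ji gtn_eqF.
  rewrite addrAC mulNr; exact: pair_weight_shift t0 (sl _ _ jkN).
case: eqVneq => [ki|ki]; last by rewrite !lj.
rewrite ki in jkN *; rewrite li (lj j ji).
have h := sl' _ _ jkN; rewrite li (lj j ji) in h.
(* Particle [i] moves towards [j], so the identity is applied at the gap of
   [l'], the smaller one. *)
set d := l j - (l i + 1) in h *.
have -> : l j - l i = d + 1 by rewrite /d; ring.
have -> : l i + 1 - l j = - d by rewrite /d; ring.
have -> : l i - l j = - (d + 1) by rewrite /d; ring.
move: d h => {sl sl'} d h.
rewrite (invrN d) mulrNN (invrN (d + 1)) mulrN.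
exact: esym (pair_weight_shift t0 h).
Qed.

Lemma one_body_shift (M N : nat) (l l' : nat -> R) (i : nat) :
    0 < theta -> (i < N)%N ->
    (forall j, j != i -> l' j = l j) -> l' i = l i + 1 ->
    0 <= l i -> l' i <= M%:R + N%:R * theta - theta ->
  one_body M N l' * l' i = one_body M N l * (M%:R + N%:R * theta - theta - l i).
Proof.
move=> t0 iN lj li l0 lM; rewrite /one_body.
rewrite (bigD1 (Ordinal iN))//= [in RHS](bigD1 (Ordinal iN))//=.
rewrite (eq_bigr (fun j : 'I_N =>
  1 / (Gamma (l j + 1) * Gamma (M%:R + N%:R * theta - l j + 1 - theta)))); last first.
  by move=> j; rewrite -val_eqE/= => ji; rewrite lj.
move: (\prod_(j < N | _) _) => A.
rewrite li in lM *; move: (l i) l0 lM => y l0 lM.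
move: (M%:R + N%:R * theta) lM => c lM.
have y0 : 0 < y + 1 by lra.
have y1 : 0 < c - (y + 1) + 1 - theta by lra.
rewrite (_ : c - y + 1 - theta = c - (y + 1) + 1 - theta + 1); last by ring.
rewrite (_ : c - theta - y = c - (y + 1) + 1 - theta); last by ring.
rewrite (GammaD1 y0) (GammaD1 y1).
move: (Gamma_gt0 y0) (Gamma_gt0 y1).
move: (c - (y + 1) + 1 - theta) y1 => v v0.
move: (Gamma (y + 1)) (Gamma v) => g g' g0 g'0.
by field; rewrite !gt_eqF.
Qed.

(** The cancellation of poles: the residue of the first Nekrasov term at [l']
    against that of the second at [l], where [l'] is [l] with its particle [i]
    moved up by one. *)
Lemma weight_shift (M N : nat) (l l' : N.-tuple R) (i : nat) :
    0 < theta -> (i < N)%N ->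
    (forall j, j != i -> l'`_j = l`_j) -> l'`_i = l`_i + 1 ->
    spaced N (nth 0 l) -> spaced N (nth 0 l') ->
    0 <= l`_i -> l'`_i <= M%:R + N%:R * theta - theta ->
  weight theta M l' * (l'`_i * residue (- theta) N (nth 0 l') i) =
  weight theta M l *
    ((M%:R + N%:R * theta - theta - l`_i) * residue theta N (nth 0 l) i).
Proof.
move=> t0 iN lj li sl sl' l0 lM; rewrite !weightE.
have EP := interaction_shift t0 iN lj li sl sl'.
have EQ := one_body_shift t0 iN lj li l0 lM.
move: (interaction _ _) (one_body _ _ _) (residue _ _ _ _) EP EQ => A B r.
move: (interaction _ _) (one_body _ _ _) (residue _ _ _ _) => A' B' r' EP EQ.
transitivity ((A * r) * (B * l'`_i)); first by ring.
by rewrite EP EQ; ring.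
Qed.

Lemma weight_gt0 (M N : nat) (l : N.-tuple R) : 0 < theta ->
    spaced N (nth 0 l) ->
    (forall i, (i < N)%N -> 0 <= l`_i <= M%:R + N%:R * theta - theta) ->
  0 < weight theta M l.
Proof.
move=> t0 sl bl; rewrite weightE mulr_gt0//.
  apply: prodr_gt0 => i _; apply: prodr_gt0 => j ij.
  by apply: pair_weight_gt0 => //; apply: sl; rewrite ij ltn_ord.
apply: prodr_gt0 => i _; have /andP[h0 hM] := bl i (ltn_ord i).
by apply: divr_gt0 => //; apply: mulr_gt0; apply: Gamma_gt0; lra.
Qed.
End Weight.

(** * Configurations *)

Section Parts.
Variables (M N : nat).
Implicit Types (lam : N.-tuple 'I_M.+1) (i : 'I_N).

Definition part lam (j : nat) : nat := nth 0%N [seq val k | k <- lam] j.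

Lemma part_tnth lam i : part lam i = tnth lam i.
Proof.
rewrite /part (nth_map (tnth lam i)) ?size_tuple//.
by congr val; rewrite -tnth_nth.
Qed.

Lemma part_le lam j : (part lam j <= M)%N.
Proof.
have [jN|jN] := ltnP j N; first by rewrite (part_tnth lam (Ordinal jN)) -ltnS.
by rewrite /part nth_default// size_map size_tuple.
Qed.

Lemma nonincreasing_partsP lam :
  reflect (forall j, (j.+1 < N)%N -> (part lam j.+1 <= part lam j)%N)
    (nonincreasing_parts lam).
Proof.
by apply: (iffP (sortedP 0%N)); rewrite size_map size_tuple.
Qed.

Lemma nonincreasing_parts_le lam j k : nonincreasing_parts lam ->
  (j <= k < N)%N -> (part lam k <= part lam j)%N.
Proof.
move=> /nonincreasing_partsP h; elim: k => [|k IH].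
  by rewrite leqn0 => /andP[/eqP->].
rewrite leq_eqVlt => /andP[/orP[/eqP->//|jk] kN].
by apply: leq_trans (h _ kN) (IH _); rewrite -ltnS jk ltnW.
Qed.

(** Wraps around from [M] to [0], which makes the map a bijection of all tuples
    and so allows reindexing a sum by it. *)
Definition incr_part i lam : N.-tuple 'I_M.+1 :=
  [tuple if j == i then ordS (tnth lam j) else tnth lam j | j < N].

Lemma incr_part_inj i : injective (incr_part i).
Proof.
move=> lam lam' h; apply: eq_from_tnth => j.
have := congr1 (fun t => tnth t j) h; rewrite !tnth_mktuple.
by case: eqP => // _; exact: (can_inj (@ordSK _)).
Qed.

Lemma part_incr i lam j : (part lam i < M)%N -> (j < N)%N ->
  part (incr_part i lam) j = (part lam j + (j == i))%N.
Proof.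
move=> liM jN; have e := part_tnth _ (Ordinal jN).
rewrite [LHS]e tnth_mktuple -val_eqE /=.
case: eqP => [ji|_]; last by rewrite addn0; exact: esym (e lam).
transitivity ((part lam j).+1 %% M.+1)%N; first by rewrite [part lam j](e lam).
by rewrite addn1 modn_small// ji.
Qed.

Lemma nonincreasing_incr i lam : nonincreasing_parts lam -> (part lam i < M)%N ->
    (forall j, j.+1 = i :> nat -> part lam j != part lam i) ->
  nonincreasing_parts (incr_part i lam).
Proof.
move=> /nonincreasing_partsP ni liM neq; apply/nonincreasing_partsP => j jN.
rewrite !part_incr// ?(ltnW jN)//; have := ni _ jN.
have [ji|_] := eqVneq j.+1 i; last by case: (j == i); lia.
by have := neq _ ji; rewrite -ji; lia.
Qed.

End Parts.

Section Ell.
Variables (R : realType) (theta : R) (M N : nat).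
Implicit Types (lam : N.-tuple 'I_M.+1).
Local Notation l := (ell theta).
Local Notation C := (M%:R + N%:R * theta - theta + 1 : R).

Lemma nth_ell lam j : (j < N)%N ->
  (l lam)`_j = (part lam j)%:R + (N%:R - j.+1%:R) * theta.
Proof.
move=> jN; have := tnth_mktuple
  (fun i : 'I_N => (val (tnth lam i))%:R + (N - i.+1)%:R * theta) (Ordinal jN).
rewrite (tnth_nth 0) /= => ->.
by rewrite natrB// (part_tnth lam (Ordinal jN)).
Qed.

Lemma ell_gap lam j k : 0 < theta -> nonincreasing_parts lam -> (j <= k < N)%N ->
  (k%:R - j%:R) * theta <= (l lam)`_j - (l lam)`_k.
Proof.
move=> t0 ni jkN; have /andP[jk kN] := jkN.
rewrite !nth_ell//; last exact: leq_ltn_trans kN.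
have : (part lam k)%:R <= (part lam j)%:R :> R.
  by rewrite ler_nat nonincreasing_parts_le.
rewrite -(natr1 j) -(natr1 k) => h; lra.
Qed.

Lemma ell_spaced lam : 0 < theta -> nonincreasing_parts lam ->
  spaced theta N (nth 0 (l lam)).
Proof.
move=> t0 ni j k /andP[jk kN].
have h := @ell_gap lam j k t0 ni; rewrite (ltnW jk) kN in h.
apply: le_trans (h isT); apply: ler_peMl; first exact: ltW.
by rewrite lerBrDr addrC natr1 ler_nat.
Qed.

Lemma ell_ge0 lam j : 0 < theta -> (j < N)%N -> 0 <= (l lam)`_j.
Proof.
move=> t0 jN; rewrite nth_ell// addr_ge0//; apply: mulr_ge0; last exact: ltW.
by rewrite subr_ge0 ler_nat.
Qed.

Lemma ell_le lam j : (j < N)%N -> 1 + j%:R * theta <= C - (l lam)`_j.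
Proof.
move=> jN; rewrite nth_ell// -(natr1 j).
have : (part lam j)%:R <= M%:R :> R by rewrite ler_nat part_le.
move=> h; lra.
Qed.

Lemma ell_lt lam j : 0 < theta -> (j < N)%N -> 0 < C - (l lam)`_j.
Proof.
move=> t0 jN; apply: lt_le_trans (ell_le lam jN).
by rewrite ltr_pwDl// mulr_ge0// ltW.
Qed.

Lemma spaced_distinct_on (x : nat -> R) : 0 < theta -> spaced theta N x -> distinct_on N x.
Proof.
move=> t0 sx j k jN kN; case: (ltngtP j k) => // jk _.
  by rewrite -subr_eq0 gt_eqF// (lt_le_trans t0)// sx// jk.
by rewrite eq_sym -subr_eq0 gt_eqF// (lt_le_trans t0)// sx// jk.
Qed.

Lemma weight_ell_gt0 lam : 0 < theta -> nonincreasing_parts lam ->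
  0 < weight theta M (l lam).
Proof.
move=> t0 ni; apply: weight_gt0 => // [|j jN]; first exact: ell_spaced.
rewrite ell_ge0// andTb; have := ell_le lam jN.
have : 0 <= j%:R * theta by apply: mulr_ge0; [exact: ler0n|exact: ltW].
by lra.
Qed.

Lemma residueN_ge0 (x : nat -> R) i : 0 < theta -> spaced theta N x -> (i < N)%N ->
  0 <= residue (- theta) N x i.
Proof.
move=> t0 sx iN; apply: prodr_ge0 => j /=; case: ltngtP => // ij _.
  have h : theta <= x j - x i by rewrite sx// ij.
  rewrite -[_ - _]opprB invrN mulrNN addr_ge0// divr_ge0 ?ltW//.
  exact: lt_le_trans h.
have h : theta <= x i - x j by rewrite sx// ij/=.
by rewrite mulNr subr_ge0 ler_pdivrMr ?mul1r// (lt_le_trans t0).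
Qed.

(** Particles [i] and [i.+1] are then exactly [theta] apart, so one factor
    vanishes: a particle that is blocked from moving up contributes nothing. *)
Lemma residue_eq0 lam i : 0 < theta -> (i.+1 < N)%N -> part lam i = part lam i.+1 ->
  residue theta N (nth 0 (l lam)) i.+1 = 0.
Proof.
move=> t0 iN e; have iN' := ltnW iN.
rewrite /residue (bigD1 (Ordinal iN'))/= ?ltn_eqF//.
rewrite !nth_ell// e -(natr1 i.+1).
set d := (X in _ / X); have -> : d = - theta by rewrite /d; ring.
by rewrite invrN mulrN divff ?gt_eqF// subrr mul0r.
Qed.

(** The gap to the particle of index [j] is at least [j * theta], so the product
    is bounded by that of the [1 + 1 / j], which telescopes. *)
Lemma residue0_le lam : 0 < theta -> nonincreasing_parts lam -> (0 < N)%N ->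
  residue theta N (nth 0 (l lam)) 0 <= N%:R.
Proof.
move=> t0 ni N0.
have H n : (n < N)%N ->
    \prod_(j < n.+1 | j != 0 :> nat) (1 + theta / ((l lam)`_0 - (l lam)`_j)) <= n.+1%:R.
  elim: n => [_|n IH nN]; first by rewrite big_mkcond big_ord_recr big_ord0 /= mul1r.
  rewrite big_mkcond big_ord_recr -big_mkcond /=.
  have h := @ell_gap lam 0 n.+1 t0 ni; rewrite nN subr0 in h.
  have {}h := h isT.
  have p0 : 0 < n.+1%:R * theta by rewrite mulr_gt0.
  have d0 : 0 < (l lam)`_0 - (l lam)`_n.+1 by exact: lt_le_trans h.
  apply: (@le_trans _ _ (n.+1%:R * (1 + n.+1%:R^-1))).
    apply: ler_pM.
    - apply: prodr_ge0 => j j0; rewrite addr_ge0// divr_ge0 ?ltW//.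
      apply: (lt_le_trans t0); apply: (ell_spaced t0 ni); apply/andP; split; first by rewrite lt0n.
      exact: leq_trans (ltn_ord j) (ltnW nN).
    - by rewrite addr_ge0// divr_ge0 ?ltW.
    - exact/IH/ltnW.
    - rewrite lerD2l ler_pdivrMr// mulrC ler_pdivlMr//.
      by rewrite mulrC.
  by rewrite mulrDr mulr1 divff// natr1.
have := H N.-1; rewrite prednK//; exact.
Qed.

End Ell.

(** * The Nekrasov equation at the upper edge *)

Section Nekrasov.
Variables (R : realType) (theta : R) (M N : nat).
Implicit Types (lam : N.-tuple 'I_M.+1).
Local Notation l := (ell theta).
Local Notation w lam := (weight theta M (ell theta lam)).
Local Notation C := (M%:R + N%:R * theta - theta + 1 : R).
Local Notation res a lam i := (residue a N (nth 0 (ell theta lam)) i).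

Lemma ell_incr (i : 'I_N) lam j : (part lam i < M)%N -> (j < N)%N ->
  (l (incr_part i lam))`_j = (l lam)`_j + (j == i)%:R.
Proof. by move=> iM jN; rewrite !nth_ell// part_incr// natrD addrAC. Qed.

(** The terms on the right are nonnegative, so only those coming from
    configurations of the form [incr_part i lam], with [lam] admissible and its
    particle [i] free to move, are kept; [weight_shift] identifies them with
    terms on the left. The other terms on the left, where the move is blocked,
    vanish. *)
Lemma residue_transfer (i : 'I_N) : 0 < theta ->
  \sum_(lam : N.-tuple 'I_M.+1 | nonincreasing_parts lam && (part lam i < M)%N)
     w lam * res theta lam i
  <= \sum_(lam : N.-tuple 'I_M.+1 | nonincreasing_parts lam)
       w lam * ((l lam)`_i * res (- theta) lam i / (C - (l lam)`_i)).
Proof.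
move=> t0; rewrite [leRHS](reindex_inj (@incr_part_inj _ _ i)) /=.
rewrite big_mkcond [leRHS]big_mkcond /=; apply: ler_sum => lam _.
have iN := ltn_ord i.
case: ifPn => [/andP[ni iM]|nni]; case: ifPn => [ni'|nni'] //.
- have ltC := ell_lt (incr_part i lam) t0 iN.
  have li : (l (incr_part i lam))`_i = (l lam)`_i + 1 by rewrite ell_incr// eqxx.
  have l'M : (l (incr_part i lam))`_i <= M%:R + N%:R * theta - theta.
    have := ell_le theta (incr_part i lam) iN.
    by have := mulr_ge0 (ler0n R i) (ltW t0); lra.
  have lj (j : nat) : j != i :> nat -> (l (incr_part i lam))`_j = (l lam)`_j.
    move=> ji; have [jN|jN] := ltnP j N; last by rewrite !nth_default// size_tuple.
    by rewrite ell_incr// (negPf ji) addr0.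
  have := weight_shift t0 iN lj li (ell_spaced t0 ni) (ell_spaced t0 ni') (ell_ge0 lam t0 iN) l'M.
  rewrite li in ltC *; move: ltC.
  move: (w lam) (w _) (res theta lam i) (res _ _ _) => u u' r r'.
  move: ((l lam)`_i) (M%:R + N%:R * theta - theta) => y c c0 e.
  rewrite mulrA e (_ : c + 1 - (y + 1) = c - y); last by ring.
  by rewrite mulrA mulrAC mulfK// gt_eqF//; lra.
- suff -> : res theta lam i = 0 by rewrite mulr0.
  move: nni'; case: i iN iM => -[|i] iN' iN iM /=.
    by rewrite nonincreasing_incr.
  have [e _|e] := eqVneq (part lam i) (part lam i.+1); first exact: residue_eq0.
  by rewrite nonincreasing_incr// => j [->].
- apply: mulr_ge0; first by rewrite ltW// weight_ell_gt0.
  apply: divr_ge0; last by rewrite ltW// ell_lt.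
  by apply: mulr_ge0; [exact: ell_ge0|apply: residueN_ge0 => //; exact: ell_spaced].
Qed.

(** By [sum_residue] all the residues add up to [N]; those of particles at height
    [M] vanish by [residue_eq0], except that of the first particle, which is at
    most [N] by [residue0_le]. *)
Lemma sum_residue_movable lam : 0 < theta -> (0 < N)%N -> nonincreasing_parts lam ->
  N%:R - (if part lam 0 == M then N%:R else 0) <=
  \sum_(i < N | (part lam i < M)%N) res theta lam i.
Proof.
move=> t0 N0 ni.
rewrite -[X in X - _](sum_residue theta (spaced_distinct_on t0 (ell_spaced t0 ni))).
rewrite (bigID (fun i : 'I_N => part lam i < M)%N) /= -addrA gerDl subr_le0.
set B := (if _ then _ else _).
have -> : B = \sum_(i < N | i == Ordinal N0) B by rewrite big_pred1_eq.
rewrite big_mkcond [leRHS]big_mkcond /=; apply: ler_sum => i _.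
rewrite -leqNgt -val_eqE /= /B; have iN := ltn_ord i.
have eqM j : (M <= part lam j)%N = (part lam j == M).
  by rewrite eqn_leq part_le.
case: i iN => -[|i] /= iN' iN.
  by rewrite eqM; case: ifP => // _; exact: residue0_le.
rewrite eqM; case: ifP => // /eqP e; rewrite residue_eq0//.
apply/eqP; rewrite e -eqM -[X in (X <= _)%N]e.
by apply: nonincreasing_parts_le; rewrite ?leqnSn.
Qed.

Local Notation Z := (partition_function theta M N).

(** The Nekrasov equation at z = C, kept as an inequality. Partial fractions of
    the product leave polar terms at the particles, whose weighted sum
    [residue_transfer] bounds below by residues of the second Nekrasov term, and
    [sum_residue_movable] evaluates these configuration by configuration. *)
Lemma nekrasov_bound : 0 < theta -> (0 < N)%N ->
  \sum_(lam : N.-tuple 'I_M.+1 | nonincreasing_parts lam)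
     w lam * (C * \prod_(j < N) (1 - theta / (C - (l lam)`_j))) <=
  (C - 2 * theta * N%:R) * Z +
  theta * N%:R *
    \sum_(lam : N.-tuple 'I_M.+1 | nonincreasing_parts lam && (part lam 0 == M)) w lam.
Proof.
move=> t0 N0.
(* Up to the factor - theta, the polar terms of the partial fractions. *)
pose f lam i := w lam * ((l lam)`_i * res (- theta) lam i / (C - (l lam)`_i)).
have -> : \sum_(lam : N.-tuple 'I_M.+1 | nonincreasing_parts lam)
     w lam * (C * \prod_(j < N) (1 - theta / (C - (l lam)`_j))) =
   (C - theta * N%:R) * Z -
   theta * \sum_(lam : N.-tuple 'I_M.+1 | nonincreasing_parts lam) \sum_(i < N) f lam i.
  rewrite /partition_function !mulr_sumr -sumrB; apply: eq_bigr => lam ni.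
  have := @partial_fractions_mul R (- theta) N (nth 0 (l lam)) C
    (spaced_distinct_on t0 (ell_spaced t0 ni)).
  under eq_bigr do rewrite mulNr.
  move=> ->; last by move=> i iN; rewrite -subr_eq0 gt_eqF// ell_lt.
  rewrite /f -mulr_sumr.
  under eq_bigr do rewrite -mulrA.
  rewrite -mulr_sumr; move: (\sum_(i < N) _) (w lam) => S u; ring.
suff H : N%:R * Z - N%:R *
    \sum_(lam : N.-tuple 'I_M.+1 | nonincreasing_parts lam && (part lam 0 == M)) w lam
    <= \sum_(lam : N.-tuple 'I_M.+1 | nonincreasing_parts lam) \sum_(i < N) f lam i.
  have := ler_wpM2l (ltW t0) H; lra.
rewrite exchange_big /=.
apply: le_trans (ler_sum _ (fun i _ => residue_transfer i t0)).
rewrite (exchange_big_dep (@nonincreasing_parts M N)) /=; last by move=> i lam _ /andP[].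
rewrite big_mkcondr /= -mulrBr /partition_function -sumrB mulr_sumr.
apply: ler_sum => lam ni.
rewrite -mulr_sumr (eq_bigl (fun i : 'I_N => part lam i < M)%N); last first.
  by move=> i /=; rewrite ni.
apply: le_trans (ler_wpM2l (ltW (weight_ell_gt0 t0 ni)) (sum_residue_movable t0 N0 ni)).
by case: ifP => _; rewrite ?subrr ?subr0 ?mulr0// mulrC.
Qed.

End Nekrasov.

(** * A lower bound for the probability of the event *)

Section Bounds.
Variables (R : realType) (theta : R) (M N : nat).
Implicit Types (lam : N.-tuple 'I_M.+1).
Local Notation l := (ell theta).
Local Notation w lam := (weight theta M (ell theta lam)).
Local Notation C := (M%:R + N%:R * theta - theta + 1 : R).
Local Notation Z := (partition_function theta M N).

(** Each factor increases with [x j], and at the extreme values of the [x j] the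
    product telescopes. *)
Lemma prod_gap_ge (x : nat -> R) (n : nat) : 0 < theta ->
    (forall j, (j < n)%N -> 1 + j.+1%:R * theta <= x j) ->
  (1 + n%:R * theta)^-1 <= \prod_(j < n) (1 - theta / x j).
Proof.
move=> t0; elim: n => [|n IH] h; first by rewrite big_ord0 mul0r addr0 invr1.
rewrite big_ord_recr /=.
have n0 : 0 <= n%:R * theta by rewrite mulr_ge0// ltW.
have hn := h n (ltnSn n); rewrite -natr1 mulrDl mul1r in hn *.
have IHn := IH (fun j jn => h j (ltnW jn)).
have p1 : 0 < 1 + n%:R * theta by lra.
have p2 : 0 < 1 + (n%:R * theta + theta) by lra.
have x0 : 0 < x n by lra.
apply: (@le_trans _ _ ((1 + n%:R * theta)^-1 *
    ((1 + n%:R * theta) / (1 + (n%:R * theta + theta))))).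
  by rewrite mulKf ?gt_eqF.
apply: ler_pM => //.
- by rewrite invr_ge0 ltW.
- by rewrite divr_ge0// ltW.
rewrite (_ : _ / _ = 1 - theta / (1 + (n%:R * theta + theta))); last first.
  by field; rewrite gt_eqF.
by rewrite lerD2l lerN2 ler_pM2l// lef_pV2.
Qed.

(** Only the factor of index 0 can be negative, and it is at least [- theta]; the
    others lie between 0 and 1. *)
Lemma prod_gap_geN (x : nat -> R) (n : nat) : 0 < theta ->
    (forall j, (j < n)%N -> 1 + j%:R * theta <= x j) ->
  - theta <= \prod_(j < n) (1 - theta / x j).
Proof.
case: n => [|n] t0 h; first by rewrite big_ord0; lra.
rewrite big_ord_recl /=.
set r := \prod_(_ < _) _.
have fac (j : 'I_n) : 0 <= 1 - theta / x (bump 0 j) <= 1.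
  have hj := h (bump 0 j) (ltn_ord (lift ord0 j)).
  have xt : theta < x (bump 0 j).
    apply: lt_le_trans hj; rewrite /bump /= add1n -natr1 mulrDl mul1r.
    have : 0 <= j%:R * theta by rewrite mulr_ge0// ltW.
    by lra.
  have x0 : 0 < x (bump 0 j) by exact: lt_trans xt.
  rewrite subr_ge0 ler_pdivrMr// mul1r (ltW xt)/= gerBl.
  by rewrite divr_ge0// ltW.
have r0 : 0 <= r by apply: prodr_ge0 => j _; case/andP: (fac j).
have r1 : r <= 1 by apply: prodr_ile1 => j _; exact: fac.
have h0 : 1 <= x 0%N by have := h 0%N (ltn0Sn n); rewrite mul0r addr0.
have x0 : 0 < x 0%N by exact: lt_le_trans h0.
have f0 : - theta <= 1 - theta / x 0%N.
  have : theta / x 0%N <= theta by rewrite ler_pdivrMr// ler_peMr// ltW.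
  by lra.
have := ler_wpM2r r0 f0.
have : - theta <= - theta * r by rewrite mulNr lerN2 ler_piMr// ltW.
by lra.
Qed.

Definition event_weight (T : R) : R :=
  \sum_(lam : N.-tuple 'I_M.+1 | nonincreasing_parts lam && (T <= (l lam)`_0)) w lam.

(** The Nekrasov bound is compared with a lower bound of its left-hand side, in
    which the event and its complement are treated by [prod_gap_geN] and
    [prod_gap_ge]. Solving for the weight of the event leaves the coefficient
    [C / (1 + N theta) - C + 2 theta N] in front of the partition function. *)
Lemma event_weight_bound (T : R) : 0 < theta -> (0 < N)%N ->
    M%:R <= N%:R * theta -> T + theta + 1 <= C ->
  theta * (N%:R * theta) / (1 + N%:R * theta) * Z <=
  (theta * N%:R + C * theta + C / (1 + N%:R * theta)) * event_weight T.
Proof.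
move=> t0 N0 MN TC.
have C0 : 0 <= C.
  have : theta <= N%:R * theta by rewrite ler_peMl ?ler1n// ltW.
  by have := ler0n R M; lra.
have n0 : 0 < 1 + N%:R * theta by rewrite ltr_pwDl// mulr_ge0// ltW.
have upper := nekrasov_bound M t0 N0.
have W_M : \sum_(lam : N.-tuple 'I_M.+1 | nonincreasing_parts lam && (part lam 0 == M)) w lam
    <= event_weight T.
  rewrite /event_weight big_mkcond [leRHS]big_mkcond /=; apply: ler_sum => lam _.
  case: ifPn => [/andP[ni /eqP pM]|_].
    rewrite ni /= nth_ell// pM ifT//; lra.
  by case: ifPn => // /andP[ni _]; rewrite ltW// weight_ell_gt0.
have lower : C / (1 + N%:R * theta) * (Z - event_weight T) - C * theta * event_weight T <=
  \sum_(lam : N.-tuple 'I_M.+1 | nonincreasing_parts lam)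
     w lam * (C * \prod_(j < N) (1 - theta / (C - (l lam)`_j))).
  have -> : Z - event_weight T =
      \sum_(lam : N.-tuple 'I_M.+1 | nonincreasing_parts lam && ~~ (T <= (l lam)`_0)) w lam.
    rewrite /partition_function (bigID (fun lam => T <= (l lam)`_0)).
    by rewrite -/(event_weight T) addrC addKr.
  rewrite /event_weight.
  rewrite [leRHS](bigID (fun lam => T <= (l lam)`_0)) addrC.
  rewrite -mulNr !mulr_sumr; apply: lerD; apply: ler_sum => lam /andP[ni ev].
    rewrite mulrC ler_pM2l ?weight_ell_gt0// -mulrN ler_wpM2l//.
    by apply: (@prod_gap_geN (fun j => C - (l lam)`_j)) => // j jN; exact: ell_le.
  rewrite mulrC ler_pM2l ?weight_ell_gt0// ler_wpM2l//.
  apply: (@prod_gap_ge (fun j => C - (l lam)`_j)) => // j jN.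
  have := @ell_gap _ theta _ _ lam 0 j t0 ni jN.
  rewrite subr0 -natr1 mulrDl mul1r; rewrite -ltNge in ev; lra.
have Z0 : 0 <= Z by apply: sumr_ge0 => lam ni; rewrite ltW// weight_ell_gt0.
(* The two sides differ by M / (1 + N theta) + (N theta - M). *)
have scal : theta * (N%:R * theta) / (1 + N%:R * theta) <=
    C / (1 + N%:R * theta) - C + 2 * theta * N%:R.
  rewrite -subr_ge0 (_ : _ - _ = M%:R / (1 + N%:R * theta) + (N%:R * theta - M%:R)).
    by apply: addr_ge0; [rewrite divr_ge0// ltW|rewrite subr_ge0].
  by field; rewrite gt_eqF.
apply: (le_trans (ler_wpM2r Z0 scal)).
have := ler_wpM2l (mulr_ge0 (ltW t0) (ler0n R N)) W_M.
have := le_trans lower upper.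
by move: (C / _) (\sum_(_ | _) _) (event_weight T) => u v W; lra.
Qed.

End Bounds.

Section Prob.
Variables (R : realType) (theta : R) (M N : nat).
Local Notation C := (M%:R + N%:R * theta - theta + 1 : R).
Local Notation Z := (partition_function theta M N).

Lemma partition_function_gt0 : 0 < theta -> 0 < Z.
Proof.
move=> t0; pose lam0 : N.-tuple 'I_M.+1 := nseq_tuple N ord0.
have ni0 : nonincreasing_parts lam0.
  apply/nonincreasing_partsP => j _; rewrite /part /= map_nseq !nth_nseq.
  by case: ifP; case: ifP.
rewrite /partition_function (bigD1 lam0)//= ltr_pwDl ?weight_ell_gt0//.
by apply: sumr_ge0 => lam /andP[ni _]; rewrite ltW// weight_ell_gt0.
Qed.

Lemma ensemble_probE (T : R) :
  ensemble_prob theta M (fun l : N.-tuple R => T <= l`_0) =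
  event_weight theta M N T / Z.
Proof. by rewrite /ensemble_prob /ensemble_pmf -mulr_sumr mulrC. Qed.

Lemma ensemble_prob_le1 (T : R) : 0 < theta ->
  ensemble_prob theta M (fun l : N.-tuple R => T <= l`_0) <= 1.
Proof.
move=> t0; rewrite ensemble_probE ler_pdivrMr ?partition_function_gt0// mul1r.
rewrite /event_weight /partition_function big_mkcond [leRHS]big_mkcond.
apply: ler_sum => lam _; case: (boolP (nonincreasing_parts lam)) => //= ni.
by case: ifP => // _; rewrite ltW// weight_ell_gt0.
Qed.

(** The numerator bounds the coefficient of the partition function in
    [event_weight_bound] from below for all N >= 1; the denominator bounds that
    of the event from above, divided by N. *)
Definition edge_const : R :=
  theta ^+ 2 / (1 + theta) / (2 * theta ^+ 2 + 2 * theta + 2).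

Lemma edge_const_gt0 : 0 < theta -> 0 < edge_const.
Proof.
move=> t0; have t2 : 0 < theta ^+ 2 by rewrite exprn_gt0.
by rewrite !divr_gt0//; lra.
Qed.

Lemma ensemble_prob_ge (T : R) : 0 < theta -> (0 < N)%N ->
    M%:R <= N%:R * theta -> T + theta + 1 <= C ->
  edge_const / N%:R <= ensemble_prob theta M (fun l : N.-tuple R => T <= l`_0).
Proof.
move=> t0 N0 MN TC; rewrite ensemble_probE.
have bnd := event_weight_bound t0 N0 MN TC.
have Z0 := partition_function_gt0 t0.
have W0 : 0 <= event_weight theta M N T.
  by apply: sumr_ge0 => lam /andP[ni _]; rewrite ltW// weight_ell_gt0.
move: (event_weight _ _ _ _) Z bnd Z0 W0 => W Z bnd Z0 W0.
have N1 : 1 <= N%:R :> R by rewrite ler1n.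
have M0 := ler0n R M.
move: (N%:R) (M%:R) N1 M0 MN TC bnd => n m n1 m0 mn TC bnd.
have n0 : 0 < n by lra.
have nt : 0 < n * theta by rewrite mulr_gt0.
have t2 : 0 < theta ^+ 2 by rewrite exprn_gt0.
have tn : theta <= n * theta by rewrite ler_peMl// ltW.
set c := m + n * theta - theta + 1 in TC bnd.
set b := 2 * theta ^+ 2 + 2 * theta + 2.
have b0 : 0 < b by rewrite /b; lra.
have ha : theta ^+ 2 / (1 + theta) <= theta * (n * theta) / (1 + n * theta).
  rewrite ler_pdivrMr; last by lra.
  rewrite mulrAC ler_pdivlMr; last by lra.
  by have := mulr_gt0 t0 t0; nra.
have hb : theta * n + c * theta + c / (1 + n * theta) <= b * n.
  have h1 : c / (1 + n * theta) <= 2.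
    by rewrite ler_pdivrMr /c; lra.
  have h2 : c * theta <= (2 * n * theta + 1) * theta.
    by rewrite ler_pM2r// /c; lra.
  have h3 : theta ^+ 2 = theta * theta by rewrite expr2.
  by rewrite /b h3; nra.
rewrite ler_pdivlMr// /edge_const -/b mulrAC ler_pdivrMr//.
rewrite mulrAC ler_pdivrMr//.
have := ler_wpM2r (ltW Z0) ha; have := ler_wpM2r W0 hb.
rewrite (mulrC W) (mulrAC b n W) => *; lra.
Qed.
End Prob.

Theorem proposition6p8 (R : realType) (theta Mm t : R)
    (htheta : 0 < theta) (hMm : 0 < Mm <= theta)
    (ht : theta <= t < Mm + theta) :
  (fun N : nat =>
     (N%:R : R)^-1 *
     ln (ensemble_prob theta (Num.truncn (Mm * N%:R))
           (fun l : N.-tuple R => t * N%:R <= l`_0)))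
    @ \oo --> (0 : R).
Proof.
have /andP[Mm0 Mmt] := hMm; have /andP[tt tM] := ht.
set kappa := edge_const theta.
have k0 : 0 < kappa by exact: edge_const_gt0.
have d0 : 0 < Mm + theta - t by lra.

(* It suffices that exp (- e N) <= kappa / N, which follows from the quadratic
   lower bound of the exponential when N >= 2 / (kappa e^2). *)
apply/cvgrPdist_le => e e0.
have ke : 0 < kappa * e ^+ 2 by exact: mulr_gt0 k0 (exprn_gt0 2 e0).
near=> N.
have N1 : 1 <= N%:R :> R by near: N; exact: nbhs_infty_ger.
have Ne : 2 / (kappa * e ^+ 2) <= N%:R by near: N; exact: nbhs_infty_ger.
have Nd : (2 * theta + 1) / (Mm + theta - t) <= N%:R by near: N; exact: nbhs_infty_ger.
have n0 : 0 < N%:R :> R by lra.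
have N0 : (0 < N)%N by rewrite -(ltr0n R).
have MN0 : 0 <= Mm * N%:R by rewrite mulr_ge0// ltW.
have /andP[Mle Mgt] := truncn_itv MN0; rewrite -natr1 in Mgt.
set M := Num.truncn _ in Mle Mgt *.
have MN : M%:R <= N%:R * theta.
  by apply: (le_trans Mle); rewrite mulrC ler_pM2l.
have TC : t * N%:R + theta + 1 <= M%:R + N%:R * theta - theta + 1.
  by rewrite ler_pdivrMr// in Nd; lra.
have p1 := ensemble_prob_le1 M N (t * N%:R) htheta.
have pge := ensemble_prob_ge htheta N0 MN TC.
move: (ensemble_prob _ _ _) p1 pge => p p1 pge.
have p0 : 0 < p by apply: lt_le_trans pge; exact: divr_gt0.
rewrite sub0r normrN ler0_norm; last first.
  by apply: mulr_ge0_le0; [rewrite invr_ge0 ltW|exact: ln_le0].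
rewrite -mulrN ler_pdivrMl// lerNl.
rewrite -ler_expR lnK ?posrE//; apply: le_trans pge.
have en0 : 0 <= N%:R * e by rewrite mulr_ge0 ?ltW.
have := expR_ge1Dxn 1 en0; rewrite -/kappa => ge.
rewrite expRN -[leRHS]invrK lef_pV2 ?posrE ?expR_gt0 ?invr_gt0 ?(divr_gt0 k0 n0)//.
apply: le_trans ge; rewrite invf_div.
rewrite (ler_pdivrMr _ _ ke) in Ne.
rewrite ler_pdivrMr//.
have h : N%:R * 2 <= (N%:R * e) ^+ 2 * kappa.
  rewrite exprMn expr2 -!mulrA ler_pM2l// mulrCA mulrC; lra.
rewrite (_ : 2`! = 2)%N; last by [].
move: ((_ * e) ^+ 2) h => z h; lra.
Unshelve. all: by end_near. Qed.
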